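(* Let $\Gamma^1=(G,\sigma_1,\mu_1)$ be a $\gamma_1$-regular signed graph on $n_1$ vertices and $m_1$ edges, let $\theta$ be any $r$-orientation of the edges of $\Gamma^1$, and let $\Gamma^2=(H,\sigma_2,\mu_2)$ be any signed graph on $n_2$ vertices and $m_2$ edges. Let $\lambda_1(L(\Gamma^1)),\dots,\lambda_{n_1}(L(\Gamma^1))$ be the eigenvalues of $L(\Gamma^1)$. If $\lambda$ is not a pole of $\Sigma_{L(\Gamma^2)}(\lambda-2)$, then $$f_{L((\Gamma^1\diamond\Gamma^2)_\theta)}(\lambda)=\big(f_{L(\Gamma^2)}(\lambda-2)\big)^{m_1}\prod_{j=1}^{n_1}\Big[\lambda-\lambda_j(L(\Gamma^1))-\gamma_1n_2+\big(\lambda_j(L(\Gamma^1))-2\gamma_1\big)\Sigma_{L(\Gamma^2)}(\lambda-2)\Big].$$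
   Context: A signed graph $\Gamma=(G,\sigma,\mu)$ has a finite simple graph $G$ with vertices $v_1,\dots,v_n$, signature $\sigma:E(G)\to\{\pm1\}$ and marking $\mu:V(G)\to\{\pm1\}$; $\mu(\Gamma)=(\mu(v_1),\dots,\mu(v_n))^T$. $A(\Gamma)$ has $(i,j)$ entry $\sigma(v_iv_j)$ if $v_i\sim v_j$ and $0$ otherwise; $D(\Gamma)$ is the diagonal matrix of (unsigned) vertex degrees; the signed Laplacian is $L(\Gamma)=D(\Gamma)-A(\Gamma)$. $\gamma$-regular means all degrees equal $\gamma$. $f_M(\lambda)=\det(\lambda I-M)$. The signed $N$-coronal of a matrix $N$ associated with $\Gamma$ is the rational function $\Sigma_N(X)=\mu(\Gamma)^T(XI_n-N)^{-1}\mu(\Gamma)$. An $r$-orientation of $(G,\sigma)$ is a map $\theta:V(G)\times E(G)\to\{-1,0,1\}$ with $\theta(w,uv)=0$ for $w\notin\{u,v\}$, $\theta(u,uv)\in\{\pm1\}$ at endpoints, and $\theta(u,uv)\theta(v,uv)=\sigma(uv)$. The edge corona $(\Gamma^1\diamond\Gamma^2)_\theta$ (with $E(\Gamma^1)=\{e_1,\dots,e_{m_1}\}$) is obtained from $\Gamma^1$ and $m_1$ disjoint copies of $\Gamma^2$ by joining, for each $t$, both endpoints $u$ of $e_t$ to every vertex $w$ of the $t$-th copy, the edge $uw$ having sign $\theta(u,e_t)\mu_2(w)$, where $\mu_2(w)$ is the marking of the vertex of $\Gamma^2$ corresponding to $w$. *)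

(* Defs.v *)
From HB Require Import structures.
From mathcomp Require Import all_boot all_order all_algebra.

Set Implicit Arguments.
Unset Strict Implicit.
Unset Printing Implicit Defensive.

Import Order.TTheory GRing.Theory Num.Theory.
Local Open Scope ring_scope.

Definition is_sign (s : int) : bool := (s == 1) || (s == -1).

Lemma is_signM (s t : int) : is_sign s -> is_sign t -> is_sign (s * t).
Proof. by case/orP=> /eqP->; case/orP=> /eqP->. Qed.

(* The pair (G, sigma): a finite simple graph with a signature.  The signature
   of the edge uv is [sgn u v], a function of the unordered pair; its values
   on non-adjacent pairs are irrelevant. *)
Record sgraph (V : finType) := SGraph {
  adj : rel V;
  sgn : V -> V -> int;
  adj_sym : symmetric adj;
  adj_irrefl : irreflexive adj;
  sgn_sym : forall u v, adj u v -> sgn u v = sgn v u;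
  sgn_is_sign : forall u v, adj u v -> is_sign (sgn u v)
}.

(* The triple (G, sigma, mu). *)
Record signed_graph (V : finType) := SignedGraph {
  sgraph_of :> sgraph V;
  mark : V -> int;
  mark_is_sign : forall v, is_sign (mark v)
}.

Definition edges (V : finType) (G : sgraph V) : {set {set V}} :=
  [set e | [exists u, exists v, adj G u v && (e == [set u; v])]].

Definition edge (V : finType) (G : sgraph V) : finType :=
  {e : {set V} | e \in edges G}.

Definition degree (V : finType) (G : sgraph V) (u : V) : nat :=
  #|[set v | adj G u v]|.

Definition regular (V : finType) (G : sgraph V) (gamma : nat) : Prop :=
  forall u, degree G u = gamma.

Record r_orientation (V : finType) (G : sgraph V) := ROrientation {
  theta :> V -> edge G -> int;
  theta_out : forall (w : V) (e : edge G), w \notin val e -> theta w e = 0;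
  theta_in : forall (u : V) (e : edge G), u \in val e -> is_sign (theta u e);
  theta_sgn : forall (u v : V) (e : edge G), u != v -> val e = [set u; v] ->
    theta u e * theta v e = sgn G u v
}.

Section EdgeCorona.
Variables (V1 V2 : finType) (G1 : signed_graph V1) (th : r_orientation G1).
Variable G2 : signed_graph V2.

(* [inr (t, w)] is the copy of the vertex w of the second graph that is
   attached to the edge t of the first one. *)
Definition corona_vertex : finType := (V1 + edge G1 * V2)%type.

Definition corona_adj : rel corona_vertex := fun x y =>
  match x, y with
  | inl u, inl v => adj G1 u v
  | inl u, inr (t, _) => u \in val t
  | inr (t, _), inl u => u \in val t
  | inr (t, w), inr (t', w') => (t == t') && adj G2 w w'
  end.

Definition corona_sgn (x y : corona_vertex) : int :=
  match x, y with
  | inl u, inl v => sgn G1 u v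
  | inl u, inr (t, w) => th u t * mark G2 w
  | inr (t, w), inl u => th u t * mark G2 w
  | inr (_, w), inr (_, w') => sgn G2 w w'
  end.

Lemma corona_adj_sym : symmetric corona_adj.
Proof.
by move=> [u|[t w]] [v|[t' w']] //=; rewrite ?(eq_sym t) ?(adj_sym _ u) ?(adj_sym _ w).
Qed.

Lemma corona_adj_irrefl : irreflexive corona_adj.
Proof. by move=> [u|[t w]] /=; rewrite adj_irrefl ?andbF. Qed.

Lemma corona_sgn_sym x y : corona_adj x y -> corona_sgn x y = corona_sgn y x.
Proof.
case: x y => [u|[t w]] [v|[t' w']] //=; first exact: sgn_sym.
by case/andP=> _; apply: sgn_sym.
Qed.

Lemma corona_sgn_is_sign x y : corona_adj x y -> is_sign (corona_sgn x y).
Proof.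
case: x y => [u|[t w]] [v|[t' w']] /=.
- exact: sgn_is_sign.
- by move=> ut; rewrite is_signM ?mark_is_sign ?theta_in.
- by move=> vt; rewrite is_signM ?mark_is_sign ?theta_in.
- by case/andP=> _; apply: sgn_is_sign.
Qed.

Definition edge_corona : sgraph corona_vertex :=
  SGraph corona_adj_sym corona_adj_irrefl corona_sgn_sym corona_sgn_is_sign.

End EdgeCorona.

(* The vertices v_1, ..., v_n are listed by [enum_val : 'I_#|V| -> V]. *)
Section Matrices.
Variables (F : fieldType) (V : finType).

Definition adjacency_mx (G : sgraph V) : 'M[F]_#|V| :=
  \matrix_(i, j) (if adj G (enum_val i) (enum_val j)
                  then (sgn G (enum_val i) (enum_val j))%:~R else 0).

Definition degree_mx (G : sgraph V) : 'M[F]_#|V| :=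
  diag_mx (\row_i (degree G (enum_val i))%:R).

Definition laplacian (G : sgraph V) : 'M[F]_#|V| :=
  degree_mx G - adjacency_mx G.

Definition mark_vec (G : signed_graph V) : 'cV[F]_#|V| :=
  \col_i (mark G (enum_val i))%:~R.

End Matrices.

Definition char_fun (F : fieldType) (n : nat) (M : 'M[F]_n) (x : F) : F :=
  \det (x%:M - M).

Section RationalFunctions.
Variable F : fieldType.

Definition ratfun_const (c : F) : {fraction {poly F}} :=
  FracField.tofrac c%:P.

Definition ratfun_X : {fraction {poly F}} := FracField.tofrac ('X : {poly F}).

(* Numerator and denominator in lowest terms, up to a common nonzero constant
   factor, so that removable singularities do not count as poles. *)
Definition ratfun_num (f : {fraction {poly F}}) : {poly F} :=
  \n_(repr f) %/ gcdp \n_(repr f) \d_(repr f).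

Definition ratfun_den (f : {fraction {poly F}}) : {poly F} :=
  \d_(repr f) %/ gcdp \n_(repr f) \d_(repr f).

Definition is_pole (f : {fraction {poly F}}) (x : F) : bool :=
  root (ratfun_den f) x.

(* Meaningful only where f has no pole. *)
Definition ratfun_eval (f : {fraction {poly F}}) (x : F) : F :=
  (ratfun_num f).[x] / (ratfun_den f).[x].

End RationalFunctions.

Definition coronal (F : fieldType) (V : finType) (G : signed_graph V)
    (N : 'M[F]_#|V|) : {fraction {poly F}} :=
  let mu := map_mx (@ratfun_const F) (mark_vec F G) in
  (mu^T *m invmx ((ratfun_X F)%:M - map_mx (@ratfun_const F) N) *m mu) 0 0.

(* Main.v *)
Require Import Defs.
From HB Require Import structures.
From mathcomp Require Import all_boot all_order all_algebra.
From mathcomp Require Import perm mxtens ring.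

(** Ordering the vertices of the corona as V1 followed by E1 x V2, the matrix
    xI - L of the edge corona is the block matrix
      [ (x - gamma1 n2)I - L1     R kron mu2^T            ]
      [ R^T kron mu2              I kron ((x-2)I - L2)    ]
    where R is the oriented incidence matrix, for which R R^T = D1 + A1 =
    2 gamma1 I - L1.  The Schur complement of the lower right block is
    (x - gamma1 n2)I - L1 - Sigma(x-2) R R^T, an affine function of L1.
    If x-2 is an eigenvalue of L2 the lower right block is singular although
    Sigma may have no pole there, so the identity is first proved for
    polynomials in 'X = x-2, cleared of denominators, where f_{L2} can be
    cancelled; only then is it specialized. *)

Set Implicit Arguments.
Unset Strict Implicit.
Unset Printing Implicit Defensive.

Import Order.TTheory GRing.Theory Num.Theory.
Local Open Scope ring_scope.

(** * Determinants of reindexed, Kronecker and block matrices *)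

Section Determinants.
Variable R : comNzRingType.

(** The same permutation acts on rows and columns, so its sign occurs twice and cancels. This allows
    the vertices of the corona to be listed in block order. *)
Lemma det_mxsub_bij (n m : nat) (h : 'I_n -> 'I_m) (A : 'M[R]_m) :
  bijective h -> \det (mxsub h h A) = \det A.
Proof.
move=> bij_h; have nm : n = m.
  by rewrite -(card_ord n) (bij_eq_card bij_h) card_ord.
case: m / nm h A bij_h => h A bij_h.
pose s := perm (bij_inj bij_h).
have -> : mxsub h h A = row_perm s (col_perm s A).
  by apply/matrixP=> i j; rewrite !mxE !permE.
rewrite row_permE col_permE !det_mulmx !det_perm odd_permV mulrCA -signr_addb.
by rewrite addbb mulr1.
Qed.

Lemma det_tens1mx (m n : nat) (N : 'M[R]_n) :
  \det ((1%:M : 'M_m) *t N) = \det N ^+ m.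
Proof.
elim: m => [|m IHm]; first by rewrite expr0 det_mx00.
(* The first [n] Kronecker indices form copy 0 of [N]; the others are those of the [m]-fold product
   with the copy number raised by one. *)
have unindexl (k : 'I_n) :
    @mxtens_unindex m.+1 n (lshift (m * n) k) = (ord0, k).
  by congr (_, _); apply: val_inj; rewrite /= ?divn_small ?modn_small.
have unindexr (k : 'I_(m * n)) : @mxtens_unindex m.+1 n (rshift n k) =
    (lift ord0 (mxtens_unindex k).1, (mxtens_unindex k).2).
  have n_gt0 : (0 < n)%N by case: (posnP n) k => // -> [k]; rewrite muln0.
  congr (_, _); apply: val_inj => /=; last by rewrite modnDl.
  by rewrite divnDl // divnn n_gt0.
have -> : (1%:M : 'M_m.+1) *t N =
    block_mx N 0 0 ((1%:M : 'M_m) *t N) :> 'M_(n + m * n).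
  apply/matrixP=> i j; rewrite -(splitK i) -(splitK j) [LHS]mxE.
  case: (split i) (split j) => k [] l; rewrite /unsplit.
  - by rewrite block_mxEul !unindexl mxE mul1r.
  - by rewrite block_mxEur unindexl unindexr !mxE mul0r.
  - by rewrite block_mxEdl unindexl unindexr !mxE mul0r.
  - by rewrite block_mxEdr !unindexr !mxE (inj_eq lift_inj).
by rewrite det_ublock IHm exprS.
Qed.

(* Cleared of denominators, so that [D] need not be invertible. *)
Lemma det_block_schur (n p : nat) (A : 'M[R]_n) (B : 'M_(n, p)) (C : 'M_(p, n))
    (D D' : 'M_p) (d : R) : D *m D' = d%:M ->
  d ^+ n * \det (block_mx A B C D) = \det D * \det (d *: A - B *m D' *m C).
Proof.
move=> DD'.
(* Right multiplication by this matrix makes the lower left block [d *: C - D *m D' *m C], which is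
   0. *)
have <- : \det (block_mx d%:M 0 (- (D' *m C)) (1%:M : 'M_p)) = d ^+ n.
  by rewrite det_lblock det1 mulr1 det_scalar.
rewrite mulrC -det_mulmx mulmx_block !mulmx0 !mulmx1 !mul_mx_scalar !add0r.
by rewrite !mulmxN !mulmxA DD' mul_scalar_mx subrr det_ublock mulrC.
Qed.

(* The Kronecker product of [S] and [u^T], with [n] instead of [n * 1] rows. *)
Definition coupling_mx (n m p : nat) (S : 'M[R]_(n, m)) (u : 'cV[R]_p) :
    'M[R]_(n, m * p) :=
  \matrix_(i, k) (S i (mxtens_unindex k).1 * u (mxtens_unindex k).2 0).

(** Mixed-product rule for Kronecker products, whose second factor here is the 1 by 1 matrix
    [u^T *m Q *m u]. *)
Lemma mul_coupling_mx (n m p : nat) (S : 'M[R]_(n, m)) (u : 'cV[R]_p) (Q : 'M_p) :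
  coupling_mx S u *m (1%:M *t Q) *m (coupling_mx S u)^T =
  (u^T *m Q *m u) 0 0 *: (S *m S^T).
Proof.
have -> : coupling_mx S u *m (1%:M *t Q) = coupling_mx S ((u^T *m Q)^T).
  apply/matrixP=> i k; case: (mxtens_indexP k) => e w.
  (* With [S] written as [S *m 1%:M], the right side is a product of two sums, which [mulr_sum]
     merges into one over Kronecker indices. *)
  rewrite !mxE mxtens_indexK /= -[S in RHS]mulmx1 !mxE mulr_sum.
  by apply: eq_bigr => l _; rewrite !mxE mxtens_indexK mulrACA.
apply/matrixP=> i j; rewrite !mxE mulrC mulr_sum.
by apply: eq_bigr => k _; rewrite !mxE mulrACA.
Qed.

(** Schur complement with [1%:M *t \adj N] as the inverse of the lower right block up to the factor
    [\det N]. *)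
Lemma det_corona_block (n m p : nat) (A : 'M[R]_n) (S : 'M[R]_(n, m))
    (N : 'M[R]_p) (u : 'cV[R]_p) :
  \det N ^+ n *
    \det (block_mx A (coupling_mx S u) (coupling_mx S u)^T (1%:M *t N)) =
  \det N ^+ m *
    \det (\det N *: A - (u^T *m \adj N *m u) 0 0 *: (S *m S^T)).
Proof.
rewrite -mul_coupling_mx -[in RHS]det_tens1mx; apply: det_block_schur.
rewrite tensmx_mul mulmx1 mul_mx_adj.
apply/matrixP=> k l.
case: (mxtens_indexP k) => e w; case: (mxtens_indexP l) => f z.
rewrite tensmxE !mxE (can_eq (@mxtens_indexK _ _)) xpair_eqE.
by case: (e == f); case: (w == z); rewrite /= ?(mulr0, mul0r, mul1r).
Qed.

End Determinants.

(** * Rational functions, the coronal and characteristic polynomials *)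

Section RationalFunctions.
Variable F : fieldType.

Lemma ratfun_repr (f : {fraction {poly F}}) :
  f * FracField.tofrac \d_(repr f) = FracField.tofrac \n_(repr f).
Proof.
rewrite -{1}[f]reprK; move: (repr f) => x.
rewrite -[LHS]/(FracField.mul _ _) !piE; apply/eqmodP.
rewrite /= FracField.equivfE /FracField.mulf.
by rewrite !numden_Ratio ?mulf_neq0 ?oner_eq0 ?denom_ratioP // !mulr1 mulrC.
Qed.

(** Carries any presentation of [f] over to the reduced one, which defines poles and values.
    Multiplying by the gcd restores the chosen representative, and the fraction field settles the
    rest. *)
Lemma ratfun_numden (f : {fraction {poly F}}) (a b : {poly F}) :
  f * FracField.tofrac b = FracField.tofrac a ->
  ratfun_num f * b = a * ratfun_den f.
Proof.
move=> fb; have d_neq0 : \d_(repr f) != 0 := denom_ratioP _.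
have g_neq0 : gcdp \n_(repr f) \d_(repr f) != 0.
  by rewrite gcdp_eq0 negb_and d_neq0 orbT.
apply: (mulIf g_neq0); rewrite /ratfun_num /ratfun_den.
rewrite mulrAC -(mulrA a) !divpK ?dvdp_gcdl ?dvdp_gcdr //.
apply/eqP; rewrite -tofrac_eq !tofracM -ratfun_repr -fb.
by rewrite mulrAC.
Qed.

(** The inverse of [X - N] is its adjugate divided by the characteristic polynomial. *)
Lemma coronal_char_poly (V : finType) (G : signed_graph V) (N : 'M[F]_#|V|) :
  let u := map_mx polyC (mark_vec F G) in
  coronal G N * FracField.tofrac (char_poly N) =
  FracField.tofrac ((u^T *m \adj (char_poly_mx N) *m u) 0 0).
Proof.
move=> u; rewrite /coronal.
have -> : map_mx (@ratfun_const F) (mark_vec F G) =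
          map_mx (@FracField.tofrac _) u.
  by apply/matrixP=> i j; rewrite !mxE.
have -> : (ratfun_X F)%:M - map_mx (@ratfun_const F) N =
          map_mx (@FracField.tofrac _) (char_poly_mx N).
  by apply/matrixP=> i j; rewrite !mxE rmorphB rmorphMn.
have d_neq0 : FracField.tofrac (char_poly N) != 0.
  by rewrite tofrac_eq0 monic_neq0 ?char_poly_monic.
rewrite /invmx unitmxE det_map_mx unitfE d_neq0 -map_mx_adj map_trmx.
rewrite -scalemxAr -scalemxAl -!map_mxM [in LHS]mxE mulrC mulrA.
by rewrite mulfV ?mul1r // mxE.
Qed.

Lemma map_horner_scalar_sub (n : nat) (p : {poly F}) (M : 'M[F]_n) (x : F) :
  map_mx (horner_eval x) (p%:M - map_mx polyC M) = p.[x]%:M - M.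
Proof.
by apply/matrixP=> i j; rewrite !mxE rmorphB rmorphMn /= /horner_eval hornerC.
Qed.

Lemma char_funE (n : nat) (L : 'M[F]_n) (x : F) :
  char_fun L x = (char_poly L).[x].
Proof.
rewrite -[RHS]/(horner_eval x _) -det_map_mx /char_poly_mx.
by rewrite map_horner_scalar_sub hornerX.
Qed.

(** For nonzero [b] the determinant is [b ^+ n] times the characteristic polynomial at [a / b];
    [b = 0] leaves a scalar matrix. *)
Lemma det_scalar_sub (n : nat) (L : 'M[F]_n) (ev : 'I_n -> F) (a b : F) :
  char_poly L = \prod_(j < n) ('X - (ev j)%:P) ->
  \det (a%:M - b *: L) = \prod_(j < n) (a - b * ev j).
Proof.
move=> Lev; have [->|b_neq0] := eqVneq b 0.
  rewrite scale0r subr0 det_scalar -[n in LHS]card_ord -prodr_const.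
  by apply: eq_bigr => j _; rewrite mul0r subr0.
have -> : a%:M - b *: L = b *: ((a / b)%:M - L).
  by rewrite scalerBr scale_scalar_mx mulrC divfK.
rewrite detZ -/(char_fun _ _) char_funE Lev horner_prod.
rewrite -[X in b ^+ X]card_ord -prodr_const -big_split.
by apply: eq_bigr => j _ /=; rewrite !hornerE; field.
Qed.

End RationalFunctions.

(** * The oriented incidence matrix *)

Section Incidence.
Variables (F : fieldType) (V : finType) (G : sgraph V) (th : r_orientation G).

Lemma is_sign_sqr (s : int) : is_sign s -> s * s = 1.
Proof. by case/orP=> /eqP->. Qed.

Lemma edge_of_adj (u v : V) : adj G u v -> {e : edge G | val e = [set u; v]}.
Proof.
move=> uv; have e_edge : [set u; v] \in edges G.
  by rewrite inE; apply/existsP; exists u; apply/existsP; exists v; rewrite uv /=.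
by exists (exist (fun e => e \in edges G) _ e_edge).
Qed.

Lemma edge_ends (e : edge G) : exists u v, adj G u v /\ val e = [set u; v].
Proof.
have := valP e; rewrite inE => /existsP[u /existsP[v /andP[uv /eqP De]]].
by exists u, v.
Qed.

Lemma adj_neq (u v : V) : adj G u v -> u != v.
Proof. by apply: contraTneq => ->; rewrite adj_irrefl. Qed.

Lemma edge_at (e : edge G) (u : V) :
  u \in val e -> exists2 v, adj G u v & val e = [set u; v].
Proof.
have [x [y [xy De]]] := edge_ends e; rewrite De => /set2P[] ->; first by exists y.
by exists x; [rewrite adj_sym | rewrite setUC].
Qed.

Lemma card_edge : #|edge G| = #|edges G|.
Proof. by rewrite card_sig; apply: eq_card => e; rewrite inE. Qed.

Lemma card_edge_ends (e : edge G) : (\sum_u (u \in val e) = 2)%N.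
Proof.
have [u [v [uv De]]] := edge_ends e.
have -> : 2%N = #|val e| by rewrite De cards2 (adj_neq uv).
by rewrite -sum1_card [RHS]big_mkcond; apply: eq_bigr => w _; case: (w \in val e).
Qed.

(** Sending a neighbour [v] to [[set u; v]] is a bijection onto the edges at [u]; injectivity uses
    the absence of loops. *)
Lemma card_edges_at (u : V) : (\sum_(e : edge G) (u \in val e) = degree G u)%N.
Proof.
have inj_nbr : {in [set v | adj G u v] &, injective (fun v => [set u; v])}.
  move=> v w; rewrite !inE => uv uw /setP/(_ v); rewrite !inE eqxx orbT.
  by case/esym/orP=> /eqP // vu; rewrite vu adj_irrefl in uv.
rewrite /degree -(card_in_imset inj_nbr).
have <- : val @: [set e : edge G | u \in val e] =
          [set [set u; v] | v in [set v | adj G u v]].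
  apply/setP=> A; apply/imsetP/imsetP => [[e]|[v]]; rewrite inE.
    by case/edge_at=> v uv De ->; exists v; rewrite ?inE.
  by case/edge_of_adj=> e De ->; exists e; rewrite ?inE De ?set21.
rewrite (card_imset _ val_inj) -sum1_card [RHS]big_mkcond.
by apply: eq_bigr => e _; rewrite inE; case: (u \in val e).
Qed.

Definition incidence_mx : 'M[F]_(#|V|, #|edge G|) :=
  \matrix_(i, e) (th (enum_val i) (enum_val e))%:~R.

(** A diagonal entry adds one square of a sign per edge at [u]. Off the diagonal only the edge [uv]
    can contribute, and the orientation axiom makes its term the sign of [uv]. *)
Lemma mul_incidence_mx :
  incidence_mx *m incidence_mx^T = degree_mx F G + adjacency_mx F G.
Proof.
apply/matrixP=> i j; rewrite !mxE.
set u := enum_val i; set v := enum_val j.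
transitivity (((\sum_e th u e * th v e)%:~R) : F).
  rewrite rmorph_sum (reindex _ (onW_bij _ (@enum_val_bij (edge G)))) /=.
  by apply: eq_bigr => e _; rewrite !mxE rmorphM.
have [ij|neq_ij] := eqVneq i j.
  rewrite /v -ij -/u adj_irrefl addr0 mulr1n -card_edges_at natr_sum rmorph_sum.
  apply: eq_bigr => e _; have [ue|ue] := boolP (u \in val e).
    by rewrite is_sign_sqr ?theta_in.
  by rewrite theta_out // mul0r.
have neq_uv : u != v by rewrite (inj_eq enum_val_inj).
have on_both e : th u e * th v e != 0 -> adj G u v /\ val e = [set u; v].
  have [ue|ue] := boolP (u \in val e); last by rewrite theta_out ?mul0r ?eqxx.
  have [ve|ve] := boolP (v \in val e); last by rewrite mulrC theta_out ?mul0r ?eqxx.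
  have [w uw De] := edge_at ue; move: ve; rewrite De !inE eq_sym (negPf neq_uv).
  by move=> /eqP->.
rewrite mulr0n add0r; have [uv|not_uv] := boolP (adj G u v).
  have [e De] := edge_of_adj uv.
  rewrite (bigD1 e) //= (theta_sgn th neq_uv De) big1 ?addr0 // => e' ne'.
  apply/eqP; apply: contraNT ne' => /on_both[_ De'].
  by apply/eqP/val_inj; rewrite De De'.
rewrite big1 // => e _; apply/eqP.
by apply: contraNT not_uv => /on_both[].
Qed.

End Incidence.

(** * The Laplacian of the corona in block form *)

Section CoronaLaplacian.
Variables (F : fieldType) (V1 V2 : finType).
Variables (G1 : signed_graph V1) (G2 : signed_graph V2) (th : r_orientation G1).

Lemma degreeE (V : finType) (G : sgraph V) (u : V) :
  degree G u = (\sum_v adj G u v)%N.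
Proof.
rewrite /degree -sum1_card big_mkcond.
by apply: eq_bigr => v _; rewrite inE; case: (adj G u v).
Qed.

Lemma degree_corona_inl (u : V1) :
  degree (edge_corona th G2) (inl u) = (degree G1 u + degree G1 u * #|V2|)%N.
Proof.
rewrite degreeE big_sumType /= -degreeE; congr (_ + _)%N.
transitivity (\sum_(e : edge G1) \sum_(w : V2) (u \in val e))%N.
  by rewrite pair_bigA; apply: eq_bigr => -[].
rewrite -card_edges_at big_distrl; apply: eq_bigr => e _.
by rewrite sum_nat_const mulnC.
Qed.

(** The 2 counts the ends of [e]; it is the origin of the shift [lambda - 2]. *)
Lemma degree_corona_inr (e : edge G1) (w : V2) :
  degree (edge_corona th G2) (inr (e, w)) = (2 + degree G2 w)%N.
Proof.
rewrite degreeE big_sumType /= card_edge_ends; congr (_ + _)%N.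
transitivity (\sum_(e' : edge G1) \sum_w' ((e == e') && adj G2 w w'))%N.
  by rewrite pair_bigA; apply: eq_bigr => -[].
rewrite (bigD1 e) //= [X in (_ + X)%N]big1 ?addn0 => [|e' ne'].
  by rewrite degreeE; apply: eq_bigr => w' _; rewrite eqxx.
by rewrite big1 // => w' _; rewrite eq_sym (negPf ne').
Qed.

(** Passes from the index order of [block_mx] and [*t] to the enumeration of the corona's
    vertices. *)
Definition corona_index (k : 'I_(#|V1| + #|edge G1| * #|V2|)) :
    'I_#|corona_vertex V2 G1| :=
  enum_rank (match split k with
    | inl i => inl (enum_val i)
    | inr l => inr (enum_val (mxtens_unindex l).1, enum_val (mxtens_unindex l).2)
    end : corona_vertex V2 G1).

Lemma corona_index_bij : bijective corona_index.
Proof.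
pose g (x : corona_vertex V2 G1) : 'I_(#|V1| + #|edge G1| * #|V2|) :=
  unsplit (match x with
    | inl u => inl (enum_rank u)
    | inr (e, w) => inr (mxtens_index (enum_rank e, enum_rank w))
    end).
exists (fun i => g (enum_val i)) => k; rewrite /corona_index /g.
  rewrite enum_rankK -[RHS]splitK; case: (split k) => l; first by rewrite enum_valK.
  by rewrite !enum_valK -surjective_pairing mxtens_unindexK.
rewrite -[RHS]enum_valK; congr enum_rank.
case: (enum_val k) => [u|[e w]]; rewrite unsplitK ?enum_rankK //.
by rewrite mxtens_indexK !enum_rankK.
Qed.

Lemma laplacian_corona :
  let S := coupling_mx (incidence_mx F th) (mark_vec F G2) in
  mxsub corona_index corona_index (laplacian F (edge_corona th G2)) =
  block_mx (laplacian F G1 + #|V2|%:R *: degree_mx F G1) (- S) (- S^T)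
           (1%:M *t (laplacian F G2 + 2%:M)).
Proof.
move=> S.
have Lc x y : laplacian F (edge_corona th G2) (enum_rank x) (enum_rank y) =
    (degree (edge_corona th G2) x)%:R *+ (x == y) -
    (if adj (edge_corona th G2) x y then (sgn (edge_corona th G2) x y)%:~R else 0).
  by rewrite !mxE (can_eq enum_rankK) !enum_rankK.
have th_out u (e : edge G1) (c : int) : (if u \in val e then (th u e * c)%:~R else 0) =
    (th u e)%:~R * c%:~R :> F.
  by case: ifPn => [_|ue]; rewrite ?rmorphM // theta_out ?mul0r.
apply/matrixP=> i j; rewrite -(splitK i) -(splitK j) [LHS]mxE Lc !unsplitK.
case: (split i) (split j) => k [] l; rewrite /unsplit.
- rewrite -[inl _ == _]/(enum_val k == enum_val l) (inj_eq enum_val_inj).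
  rewrite block_mxEul degree_corona_inl !mxE /=.
  by rewrite natrD natrM; case: (k == l); ring.
- rewrite -[inl _ == _]/false block_mxEur mulr0n sub0r.
  case: (mxtens_indexP l) => e w; rewrite mxtens_indexK.
  by rewrite ![in RHS]mxE mxtens_indexK -th_out.
- rewrite -[inr _ == _]/false block_mxEdl mulr0n sub0r.
  case: (mxtens_indexP k) => e w; rewrite mxtens_indexK.
  by rewrite ![in RHS]mxE mxtens_indexK -th_out.
rewrite -[inr _ == _]/((_ == _) && (_ == _)) !(inj_eq enum_val_inj).
rewrite block_mxEdr degree_corona_inr.
case: (mxtens_indexP k) => e w; case: (mxtens_indexP l) => e' w'.
rewrite tensmxE !mxtens_indexK !mxE /= (inj_eq enum_val_inj).
case: (e == e'); rewrite /= ?mul0r ?mulr0n ?subr0 // mul1r.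
by rewrite natrD; case: (w == w'); ring.
Qed.

End CoronaLaplacian.

(** * The generic determinant identity and its specialization *)

Lemma degree_mx_regular (F : fieldType) (V : finType) (G : sgraph V)
    (gamma : nat) : regular G gamma -> degree_mx F G = gamma%:R%:M.
Proof. by move=> regG; apply/matrixP=> i j; rewrite !mxE regG. Qed.

(** Taking ['X + 2%:P] for lambda cancels the degree shift on the copies, so the lower right block
    is built from [char_poly_mx] itself. *)
Lemma det_corona_laplacian (F : fieldType) (V1 V2 : finType)
    (G1 : signed_graph V1) (G2 : signed_graph V2) (th : r_orientation G1)
    (gamma : nat) : regular G1 gamma ->
  let S := map_mx polyC (incidence_mx F th) in
  let u := map_mx polyC (mark_vec F G2) in
  \det (('X + 2%:P)%:M - map_mx polyC (laplacian F (edge_corona th G2))) =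
  \det (block_mx (('X + 2%:P - (gamma%:R * #|V2|%:R)%:P)%:M
                     - map_mx polyC (laplacian F G1))
                 (coupling_mx S u) (coupling_mx S u)^T
                 (1%:M *t char_poly_mx (laplacian F G2))).
Proof.
move=> regG S u; rewrite -(det_mxsub_bij _ (@corona_index_bij V1 V2 G1)).
have inj_ci := bij_inj (@corona_index_bij V1 V2 G1); congr (\det _).
transitivity (('X + 2%:P)%:M - map_mx polyC (mxsub (@corona_index V1 V2 G1)
   (@corona_index V1 V2 G1) (laplacian F (edge_corona th G2)))).
  by apply/matrixP=> i j; rewrite !mxE (inj_eq inj_ci).
rewrite laplacian_corona map_block_mx scalar_mx_block opp_block_mx add_block_mx.
rewrite !sub0r !map_mxN !opprK map_mxT map_scalar_mx; congr block_mx.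
- rewrite (degree_mx_regular F regG) scale_scalar_mx map_mxD map_scalar_mx.
  rewrite (raddfB (@scalar_mx _ _)).
  by rewrite opprD addrA addrAC mulrC.
- by apply/matrixP=> i k; rewrite !mxE /= polyCM.
- by apply/matrixP=> i k; rewrite !mxE /= polyCM.
apply/matrixP=> k l.
case: (mxtens_indexP k) => e w; case: (mxtens_indexP l) => e' w'.
rewrite [LHS]mxE [X in _ + X]mxE !tensmxE !mxE.
rewrite (can_eq (@mxtens_indexK _ _)) xpair_eqE.
by case: (e == e'); case: (w == w') => /=; ring.
Qed.

Theorem theorem4p5 (F : numFieldType) (V1 V2 : finType)
    (G1 : signed_graph V1) (G2 : signed_graph V2) (theta : r_orientation G1)
    (n1 m1 n2 m2 gamma1 : nat)
    (card_V1 : #|V1| = n1) (card_E1 : #|edges G1| = m1)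
    (card_V2 : #|V2| = n2) (card_E2 : #|edges G2| = m2)
    (regular_G1 : regular G1 gamma1)
    (ev : 'I_n1 -> F)
    (ev_spectrum :
       char_poly (laplacian F G1) = \prod_(j < n1) ('X - (ev j)%:P))
    (lambda : F)
    (lambda_not_pole : ~~ is_pole (coronal G2 (laplacian F G2)) (lambda - 2)) :
  let Sigma := ratfun_eval (coronal G2 (laplacian F G2)) (lambda - 2) in
  char_fun (laplacian F (edge_corona theta G2)) lambda =
  (char_fun (laplacian F G2) (lambda - 2)) ^+ m1 *
  \prod_(j < n1) (lambda - ev j - gamma1%:R * n2%:R
                  + (ev j - 2 * gamma1%:R) * Sigma).
Proof.
move=> Sigma; case: n1 / card_V1 ev ev_spectrum => ev ev_spectrum.
rewrite -card_E1 -card_edge -card_V2.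
set L1 := laplacian F G1; set L2 := laplacian F G2.
set c := gamma1%:R * #|V2|%:R.
pose A := ('X + 2%:P - c%:P)%:M - map_mx polyC L1 : 'M_#|V1|.
pose Q := (2 * gamma1%:R)%:M - L1 : 'M_#|V1|.
pose num := ratfun_num (coronal G2 L2); pose den := ratfun_den (coronal G2 L2).
pose x := lambda - 2; have x2 : x + 2 = lambda by rewrite subrK.
have SS : map_mx polyC (incidence_mx F theta) *m
    (map_mx polyC (incidence_mx F theta))^T = map_mx polyC Q.
  rewrite map_trmx -map_mxM; congr map_mx.
  rewrite mul_incidence_mx /Q /L1 /laplacian.
  by rewrite (degree_mx_regular F regular_G1) mulr_natl mulr2n raddfD /=
    opprB addrACA subrr addr0.
have d_neq0 : char_poly L2 != 0 by rewrite monic_neq0 ?char_poly_monic.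
have generic :
    den ^+ #|V1| *
    \det (('X + 2%:P)%:M - map_mx polyC (laplacian F (edge_corona theta G2))) =
    char_poly L2 ^+ #|edge G1| * \det (den *: A - num *: map_mx polyC Q).
  apply: (mulfI (expf_neq0 #|V1| d_neq0)).
  rewrite (det_corona_laplacian F G2 theta regular_G1) -/L1 -/L2 -/A mulrCA.
  rewrite det_corona_block SS.
  set s := (_ *m _ *m _) 0 0.
  (* This trades the adjugate numerator [s] for [num], so that both sides carry the same power of
     [char_poly L2]. *)
  have num_den : num * char_poly L2 = s * den.
    exact/ratfun_numden/coronal_char_poly.
  rewrite mulrCA -detZ mulrCA -detZ; congr (_ * \det _).
  by rewrite !scalerBr !scalerA (mulrC den s) -num_den mulrC (mulrC num).
(* This is the pole hypothesis unfolded. *)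
have den_neq0 : den.[x] != 0 by [].
have /(congr1 (horner_eval x)) := generic.
rewrite !rmorphM !rmorphXn /= -!det_map_mx /=.
have -> : map_mx (horner_eval x)
    (('X + 2%:P)%:M - map_mx polyC (laplacian F (edge_corona theta G2))) =
    lambda%:M - laplacian F (edge_corona theta G2).
  by rewrite map_horner_scalar_sub hornerD hornerX hornerC x2.
(* Dividing by [den.[x]] turns [num] into [Sigma]; collecting the multiples of [L1] gives an affine
   function of [L1], whose determinant the spectrum determines. *)
have -> : map_mx (horner_eval x) (den *: A - num *: map_mx polyC Q) =
    den.[x] *: ((lambda - c - 2 * gamma1%:R * Sigma)%:M - (1 - Sigma) *: L1).
  have map_polyCK M : map_mx (horner_eval x) (map_mx polyC M) = M :> 'M_#|V1|.
    by apply/matrixP=> i j; rewrite !mxE /horner_eval hornerC.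
  rewrite map_mxB !map_mxZ map_polyCK map_horner_scalar_sub /Q.
  rewrite /= /horner_eval !(hornerD, hornerN, hornerX, hornerC) x2.
  rewrite /Sigma /ratfun_eval -/num -/den -/x.
  (* [L1] is generalized so that [mxE] does not expand the Laplacian. *)
  move: (L1) => L; apply/matrixP=> i j; rewrite !mxE.
  by case: (i == j); rewrite ?mulr0n ?mulr1n; field.
rewrite /char_poly_mx map_horner_scalar_sub hornerX detZ mulrCA.
move=> /(mulfI (expf_neq0 _ den_neq0)).
rewrite -[\det (_ - laplacian _ _)]/(char_fun _ _) => ->.
rewrite (det_scalar_sub _ _ ev_spectrum); congr (_ * _).
by apply: eq_bigr => j _; ring.
Qed.
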